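(* Let $X$ be a Banach space with dual space $X^*$. Then the (dual) norm $\|\cdot\|_{X^*}$ is AMUC if and only if it is AMUC$^*$.
   Context: $S_Y$ denotes the unit sphere of $Y$; $\inf\emptyset=+\infty$. A Banach space $Z$ (or its norm) is AMUC (asymptotically midpoint uniformly convex) if for all $t>0$, $\inf_{z\in S_Z}\ \sup_{Y}\ \inf_{y\in S_Y}(\max\{\|z+ty\|,\|z-ty\|\}-1)>0$, the supremum being over all norm-closed subspaces $Y$ of $Z$ of finite codimension. The dual space $X^*$ (or its norm) is AMUC$^*$ if for all $t>0$, $\inf_{x^*\in S_{X^*}}\ \sup_{Y}\ \inf_{y^*\in S_Y}(\max\{\|x^*+ty^*\|,\|x^*-ty^*\|\}-1)>0$, the supremum being over all weak$^*$-closed subspaces $Y$ of $X^*$ of finite codimension. *)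

(* Defs.v *)
From HB Require Import structures.
From mathcomp Require Import all_boot all_order all_algebra.
From mathcomp Require Import all_classical all_reals all_analysis.

Set Implicit Arguments.
Unset Strict Implicit.
Unset Printing Implicit Defensive.

Import Order.TTheory GRing.Theory Num.Theory.
Import numFieldNormedType.Exports.

Local Open Scope classical_set_scope.
Local Open Scope ring_scope.

Section Dual.
Context {R : realType} {X : normedModType R}.

Definition continuous_linear_form : {pred X -> R^o} :=
  mem [set f : X -> R^o | linear f /\ continuous f].

Lemma continuous_linear_form_submod_closed :
  submod_closed continuous_linear_form.
Proof.
split.
  rewrite inE; split; last by move=> x; exact: cvg_cst.
  by move=> a u v; rewrite -[LHS]/(0 : R^o) -[_ u]/(0 : R^o) scaler0 add0r.
move=> a f g; rewrite !inE => -[fl fc] [gl gc]; split.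
  move=> b u v; rewrite -![(_ *: f + g) _]/(_ *: f _ + g _) fl gl !scalerDr !scalerA (mulrC a b).
  by rewrite addrACA.
by move=> x; apply: cvgD; [apply: cvgZr; exact: fc|exact: gc].
Qed.

HB.instance Definition _ := GRing.isSubmodClosed.Build R (X -> R^o)
  continuous_linear_form continuous_linear_form_submod_closed.

End Dual.

(* The topological dual of X; R^o is R seen as a module over itself. *)
Record dual (R : realType) (X : normedModType R) := Dual {
  dual_fun :> X -> R^o;
  _ : dual_fun \in continuous_linear_form
}.

Section DualNorm.
Context {R : realType} {X : normedModType R}.
Implicit Types f g : dual X.

HB.instance Definition _ := [isSub for @dual_fun R X].
HB.instance Definition _ := [Choice of dual X by <:].
HB.instance Definition _ := [SubChoice_isSubLmodule of dual X by <:].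

Lemma dual_linear f : linear f.
Proof. by case: f => f /= /[!inE] -[]. Qed.

HB.instance Definition _ f := GRing.isLinear.Build R X R^o *:%R f
  (dual_linear f).

Lemma dual_continuous f : continuous f.
Proof. by case: f => f /= /[!inE] -[]. Qed.

Lemma dual_eqP f g : f =1 g -> f = g.
Proof. by move=> fg; apply: val_inj; apply/funext. Qed.

Lemma dualDE f g x : (f + g) x = f x + g x. Proof. by []. Qed.

Lemma dualZE (a : R) f x : (a *: f) x = a * f x. Proof. by []. Qed.

Lemma dualBE f g x : (f - g) x = f x - g x. Proof. by []. Qed.

Definition dual_norm f : R := sup [set `|f x| | x in [set x : X | `|x| <= 1]].

Lemma dual_norm_has_sup f :
  has_sup [set `|f x| | x in [set x : X | `|x| <= 1]].
Proof.
split; first by exists `|f 0|, 0; rewrite //= normr0.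
have /(continuous_linear_bounded 0)/bounded_funP/(_ 1)[M fM] :
  {for 0, continuous (f : X -> R^o)} by exact: dual_continuous.
by exists M => _ [x /= x1 <-]; exact: fM.
Qed.

Lemma dual_norm_ub f x : `|f x| <= dual_norm f * `|x|.
Proof.
have [->|x0] := eqVneq x 0; first by rewrite linear0 !normr0 mulr0.
have nx : 0 < `|x| by rewrite normr_gt0.
rewrite -ler_pdivrMr//.
have -> : `|f x| / `|x| = `|f (`|x|^-1 *: x)|.
  by rewrite linearZ normrZ gtr0_norm ?invr_gt0// mulrC.
apply: (sup_upper_bound (dual_norm_has_sup f)).
exists (`|x|^-1 *: x) => //=.
by rewrite normrZ gtr0_norm ?invr_gt0// mulVf// gt_eqF.
Qed.

Lemma dual_norm_le f (M : R) :
  (forall x, `|x| <= 1 -> `|f x| <= M) -> dual_norm f <= M.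
Proof.
move=> fM; apply: ge_sup; first by case: (dual_norm_has_sup f).
by move=> _ [x /= x1 <-]; exact: fM.
Qed.

Lemma dual_norm_ge0 f : 0 <= dual_norm f.
Proof.
apply: (sup_upper_bound (dual_norm_has_sup f)).
by exists 0; rewrite /= ?normr0// linear0 normr0.
Qed.

Lemma dual_norm_ub1 f x : `|x| <= 1 -> `|f x| <= dual_norm f.
Proof.
move=> x1; apply: (le_trans (dual_norm_ub f x)).
by rewrite ler_piMr// dual_norm_ge0.
Qed.

Lemma dual_normD f g : dual_norm (f + g) <= dual_norm f + dual_norm g.
Proof.
apply: dual_norm_le => x x1; rewrite dualDE (le_trans (ler_normD _ _))//.
by rewrite lerD// dual_norm_ub1.
Qed.

Lemma dual_normZ (a : R) f : dual_norm (a *: f) = `|a| * dual_norm f.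
Proof.
have le_normZ (b : R) g : dual_norm (b *: g) <= `|b| * dual_norm g.
  apply: dual_norm_le => x x1; rewrite dualZE normrM.
  by rewrite ler_wpM2l// dual_norm_ub1.
apply/eqP; rewrite eq_le le_normZ/=.
have [->|a0] := eqVneq a 0; first by rewrite normr0 mul0r dual_norm_ge0.
rewrite -ler_pdivlMl ?normr_gt0// -normfV.
by rewrite (le_trans _ (le_normZ _ _))// scalerA mulVf// scale1r.
Qed.

Lemma dual_norm0_eq0 f : dual_norm f = 0 -> f = 0.
Proof.
move=> f0; apply: dual_eqP => x; apply/eqP.
by rewrite -[eqbRHS]/(0 : R) -normr_le0 (le_trans (dual_norm_ub f x))// f0 mul0r.
Qed.

HB.instance Definition _ := Lmodule_isNormed.Build R (dual X)
  dual_normD dual_normZ dual_norm0_eq0.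

Lemma dual_normE f :
  `|f| = sup [set `|f x| | x in [set x : X | `|x| <= 1]].
Proof. by []. Qed.

Lemma dual_cauchy_cvg (F : set_system (dual X)) :
  ProperFilter F -> cauchy F -> cvg F.
Proof.
move=> FF Fc.
have Fball (e : R) : 0 < e -> exists g, \forall h \near F, `|g - h| < e.
  move=> e0; have /cauchyP/(_ _ e0)[g Fg] := Fc.
  by exists g.
have Fx x : cvg ((fun g => g x) @ F).
  apply: cauchy_cvg; apply/cauchyP => e e0.
  have e0' : 0 < e / (1 + `|x|) by rewrite divr_gt0// ltr_pwDl.
  have [g Fg] := Fball _ e0'.
  exists (g x); rewrite /nbhs/=; near=> h; rewrite /ball /= -dualBE.
  apply: (le_lt_trans (dual_norm_ub _ _)).
  apply: (@le_lt_trans _ _ (`|g - h| * (1 + `|x|))).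
    by rewrite ler_wpM2l ?dual_norm_ge0// lerDr.
  by rewrite -ltr_pdivlMr ?ltr_pwDl//; near: h.
pose f0 x : R^o := lim ((fun g => g x) @ F).
have f0P x : (fun g => g x) @ F --> f0 x by exact: Fx.
have f0l : linear f0.
  move=> a u v; apply: (cvg_unique (@norm_hausdorff _ R^o) (f0P _)).
  rewrite (_ : (fun g : dual X => _) = (fun g => a *: (g u : R^o) + g v)).
    by apply: cvgD (f0P v); apply: cvgZr; exact: f0P.
  by apply/funext => g; exact: dual_linear.
have f0B (e : R) g : (\forall h \near F, `|g - h| < e) ->
    forall x, `|g x - f0 x| <= e * `|x|.
  move=> gF x.
  have gx : (fun h : dual X => `|g x - h x|) @ F --> `|g x - f0 x|.
    by apply: cvg_norm; apply: cvgB (f0P x); exact: cvg_cst.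
  apply: (closed_cvg (fun y : R => y <= e * `|x|)) gx; first exact: closed_le.
  near=> h; rewrite -dualBE (le_trans (dual_norm_ub _ _))// ler_wpM2r//.
  by apply/ltW; near: h.
pose f0L := GRing.isLinear.Build R X R^o *:%R f0 f0l.
pose f0' : {linear X -> R^o} := HB.pack f0 f0L.
have f0c : continuous f0.
  have [g Fg] := Fball 1 ltr01.
  apply: (@bounded_linear_continuous _ _ _ f0'); apply/bounded_funP => r.
  exists ((1 + dual_norm g) * r) => x xr /=.
  rewrite (_ : f0 x = g x - (g x - f0 x)); last by rewrite subKr.
  apply: (le_trans (ler_normB _ _)); rewrite mulrDl addrC lerD//.
    by rewrite (le_trans (f0B _ _ Fg x))// !mul1r.
  by rewrite (le_trans (dual_norm_ub _ _))// ler_wpM2l ?dual_norm_ge0.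
have f0D : f0 \in continuous_linear_form by rewrite inE.
apply/cvg_ex; exists (Dual f0D); apply/cvgrPdist_lt => e e0.
have e20 : 0 < e / 2 by rewrite divr_gt0.
have [g Fg] := Fball _ e20; near=> h.
rewrite (splitr e) -(subrKA g) (le_lt_trans (ler_normD _ _))// ler_ltD//.
  apply: dual_norm_le => x x1; rewrite dualBE distrC/=.
  by rewrite (le_trans (f0B _ _ Fg x))// ler_piMr// ltW.
by near: h.
Unshelve. all: by end_near. Qed.

HB.instance Definition _ := Uniform_isComplete.Build (dual X) dual_cauchy_cvg.

End DualNorm.

(* The type [dual X] with the topology of pointwise convergence on X, i.e., the
   topology induced from the product topology on X -> R. *)
Definition weak_star (R : realType) (X : normedModType R) : topologicalType :=
  initial_topology (@dual_fun R X : dual X -> {ptws X -> R^o}).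

Section AMUC.
Context {R : realType}.

Definition unit_sphere (Z : normedModType R) : set Z := [set z | `|z| = 1].

(* Z / Y is spanned by the classes of finitely many vectors. *)
Definition finite_codim (Z : lmodType R) (Y : set Z) : Prop :=
  exists (n : nat) (e : 'I_n -> Z), forall z : Z,
    exists c : 'I_n -> R, Y (z - \sum_(i < n) c i *: e i).

(* ereal_inf and ereal_sup take values in the extended reals, so the infimum
   over an empty unit sphere is +oo. The set [closedY] collects the subsets that
   are closed for the topology under consideration on Z. *)
Definition amuc_wrt (Z : normedModType R) (closedY : set (set Z)) : Prop :=
  forall t : R, 0 < t ->
  (0 < ereal_inf [set ereal_sup
         [set ereal_inf
            [set (Num.max `|z + t *: y| `|z - t *: y| - 1)%:E
              | y in Y `&` @unit_sphere Z]
           | Y in [set Y : set Z | [/\ submod_closed (mem Y),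
                                       finite_codim Y & closedY Y]]]
        | z in @unit_sphere Z])%E.

Definition AMUC (Z : completeNormedModType R) : Prop :=
  @amuc_wrt Z [set Y : set Z | closed Y].

Definition AMUC_star (X : completeNormedModType R) : Prop :=
  @amuc_wrt (dual X) [set Y : set (dual X) | closed (Y : set (weak_star X))].

End AMUC.

(* Main.v *)
Require Import Defs.
From HB Require Import structures.
From mathcomp Require Import all_boot all_order all_algebra.
From mathcomp Require Import all_classical all_reals all_analysis.
From mathcomp Require Import ring lra.

(** Weak*-closed subspaces are norm closed, so AMUC* gives AMUC at once.

    For the converse, fix x in the unit sphere of X^* and consider the set
    M = lens x rho of those m with |x + m| and |x - m| at most 1 + rho. It is
    convex and symmetric. If Y is a subspace of finite codimension witnessing
    AMUC at x with parameter s and gain d, then, for rho = d / 3, every point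
    of Y close to M has norm at most s. As M is bounded, its image in X^* / Y
    is totally bounded, and two elements m, m' of M that are close modulo Y
    satisfy |m - m'| < 4 s, because (m - m') / 2 belongs to M and is close to
    Y. Hence M is covered by finitely many balls of radius 4 s
    ([lens_net]).

    This last property does not refer to Y any more. For each centre f of the
    cover choose a point x_f of the unit ball of X at which f almost attains
    its norm, and let Y' be the annihilator of all these x_f: it is weak*
    closed and of finite codimension. If g in Y' and M lies in the ball around
    f, then |f x_f| = |(f - g) x_f| < 4 s, so that |f| < 5 s and |g| < 9 s
    ([annihilator_small]). Taking s = t / 9, no vector of norm t of Y' is in
    M, which is AMUC* at x with parameter t and gain d / 3, a gain independent
    of x. *)

Set Implicit Arguments.
Unset Strict Implicit.
Unset Printing Implicit Defensive.

Import Order.TTheory GRing.Theory Num.Theory.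
Import numFieldNormedType.Exports.

Local Open Scope classical_set_scope.
Local Open Scope ring_scope.

(** * The modulus without extended reals *)

Lemma amuc_wrtP (R : realType) (Z : normedModType R) (C : set (set Z)) :
  amuc_wrt C <-> forall t : R, 0 < t -> exists2 d : R, 0 < d &
    forall z, `|z| = 1 -> exists Y : set Z,
      [/\ submod_closed (mem Y), finite_codim Y, C Y &
        forall y, Y y -> `|y| = 1 ->
          1 + d <= Num.max `|z + t *: y| `|z - t *: y|].
Proof.
split=> h t t0.
  have [d d0 dlt] : exists2 d : R, 0 < d & (d%:E < ereal_inf [set ereal_sup
         [set ereal_inf
            [set (Num.max `|z + t *: y| `|z - t *: y| - 1)%:E
              | y in Y `&` @unit_sphere R Z]
           | Y in [set Y : set Z | [/\ submod_closed (mem Y),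
                                       finite_codim Y & C Y]]]
        | z in @unit_sphere R Z])%E.
    move: (h t t0); case: (ereal_inf _) => [r| |] //.
      rewrite lte_fin => r0; exists (r / 2); first by rewrite divr_gt0.
      by rewrite lte_fin; lra.
    by move=> _; exists 1 => //; rewrite ltry.
  exists d => // z z1.
  have := lt_le_trans dlt (ereal_inf_lbound (imageP _ z1)).
  move=> /ereal_sup_gt[_ [Y [sY cY CY] <-] dY].
  exists Y; split=> // y Yy y1.
  have := lt_le_trans dY (ereal_inf_lbound (imageP _ (conj Yy y1))).
  by rewrite lte_fin => /ltW; lra.
have [d d0 dP] := h t t0.
apply: (@lt_le_trans _ _ d%:E); first by rewrite lte_fin.
apply: le_ereal_inf_tmp => _ [z z1 <-].
have [Y [sY cY CY YP]] := dP z z1.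
apply: le_ereal_sup_tmp; eexists; first by exists Y.
apply: le_ereal_inf_tmp => _ [y [Yy y1] <-].
by rewrite lee_fin; have := YP y Yy y1; lra.
Qed.

(** * Total boundedness modulo a subspace of finite codimension *)

Lemma submod_setP (R : realType) (Z : lmodType R) (Y : set Z) :
  submod_closed (mem Y) <->
  Y 0 /\ forall a u v, Y u -> Y v -> Y (a *: u + v).
Proof.
split=> -[Y0 YD]; split.
- by move: Y0; rewrite inE.
- by move=> a u v Yu Yv; have := YD a u v; rewrite !inE; apply.
- by rewrite inE.
- by move=> a u v; rewrite !inE; exact: YD.
Qed.

Lemma segment_net (R : realType) (K eta : R) : 0 < eta ->
  exists L : seq R, forall c, `|c| <= K ->
    exists2 l, l \in L & `|c - l| <= eta.
Proof.
move=> eta0.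
exists [seq k%:R * eta - K | k <- iota 0 (Num.truncn ((K + K) / eta)).+1].
move=> c; rewrite ler_norml => /andP[Kc cK].
have q0 : 0 <= (c + K) / eta by rewrite divr_ge0 ?(ltW eta0)//; lra.
have /andP[lo hi] := Num.Theory.truncn_itv q0.
have : (Num.truncn ((c + K) / eta) <= Num.truncn ((K + K) / eta))%N.
  by apply: Num.Theory.le_truncn; rewrite ler_pM2r ?invr_gt0//; lra.
move: lo hi; set N := Num.truncn ((c + K) / eta) => lo hi NK.
exists (N%:R * eta - K).
  by apply/mapP; exists N => //; rewrite mem_iota add0n ltnS.
move: lo hi; rewrite ler_pdivlMr// ltr_pdivrMr// -natr1 mulrDl mul1r => lo hi.
by rewrite ler_norml; apply/andP; split; lra.
Qed.

(** Balls are totally bounded for the seminorm z |-> dist(z, Y). By induction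
    on the codimension, with Y1 = Y + R g for a spanning vector g: either g is
    at distance 0 from Y, and then Y and Y1 have the same seminorm, or the
    component along g of the elements of Y1 is controlled by their norm, so
    that it ranges over a segment, which has a finite net. *)
Lemma finite_codim_net (R : realType) (Z : normedModType R) (Y : set Z)
    (r eps : R) :
  submod_closed (mem Y) -> finite_codim Y -> 0 < eps ->
  exists F : seq Z, forall z, `|z| <= r ->
    exists f y, [/\ f \in F, Y y & `|z - f - y| < eps].
Proof.
move=> + [n [e]]; elim: n e Y eps => [|n IH] e Y eps sY Ye eps0.
  exists [:: 0] => z _; exists 0, z; split; first by rewrite inE.
    by have [c] := Ye z; rewrite big_ord0 subr0.
  by rewrite subr0 subrr normr0.
have /submod_setP[Y0 YD] := sY.
have YZ a y : Y y -> Y (a *: y) by move=> Yy; rewrite -[_ *: _]addr0; exact: YD.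
set g := e ord0.
pose Y1 : set Z := [set w | exists c y, Y y /\ w = c *: g + y].
have sY1 : submod_closed (mem Y1).
  apply/submod_setP; split.
    by exists 0, 0; split=> //; rewrite scale0r addr0.
  move=> a _ _ [c [y [Yy ->]]] [c' [y' [Yy' ->]]].
  exists (a * c + c'), (a *: y + y'); split; first exact: YD.
  by rewrite scalerDr scalerDl scalerA addrACA.
have Y1e z : exists c : 'I_n -> R,
    Y1 (z - \sum_(i < n) c i *: e (lift ord0 i)).
  have [c Yc] := Ye z; exists (fun i => c (lift ord0 i)).
  exists (c ord0), (z - \sum_(i < n.+1) c i *: e i); split=> //.
  by rewrite big_ord_recl opprD [RHS]addrCA addNKr.
have e20 : 0 < eps / 2 by rewrite divr_gt0.
have [F FP] := IH _ _ _ sY1 Y1e e20.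
have exchange (a u v y : Z) : a - (v + y) = a - (u + y) + (u - v).
  rewrite !opprD -addrA; congr (_ + _).
  by rewrite addrACA addNr add0r addrC.
have [gY|] := pselect (forall eta, 0 < eta -> exists2 y, Y y & `|g - y| < eta).
  exists F => z zr; have [f [_ [fF [c [y [Yy ->]]] zf]]] := FP z zr.
  have c0 : 0 < `|c| + 1 by rewrite ltr_wpDl.
  have [y' Yy' gy'] := gY _ (divr_gt0 e20 c0).
  exists f, (c *: y' + y); split=> //; first exact: YD.
  rewrite (exchange _ (c *: g)) -scalerBr.
  rewrite (splitr eps) (le_lt_trans (ler_normD _ _))// ltr_leD//.
  rewrite normrZ (@le_trans _ _ ((`|c| + 1) * `|g - y'|))//.
    by rewrite ler_wpM2r// lerDl.
  by rewrite mulrC -ler_pdivlMr// ltW.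
(* Here g is at distance at least d > 0 from Y, so that c *: g + y has norm at
   least d * `|c|. *)
move=> /existsNP[d /not_implyP[d0 gd]].
have dg y : Y y -> d <= `|g - y|.
  by move=> Yy; rewrite leNgt; apply/negP => gy; apply: gd; exists y.
have dc c y : Y y -> d * `|c| <= `|c *: g + y|.
  move=> Yy; have [->|c0] := eqVneq c 0; first by rewrite normr0 mulr0.
  have -> : c *: g + y = c *: (g - (- c^-1) *: y).
    by rewrite scaleNr opprK scalerDr scalerA divff// scale1r.
  by rewrite normrZ mulrC ler_wpM2l// dg//; exact: YZ.
have g0 : 0 < `|g| by rewrite (lt_le_trans d0)// -[g]subr0 dg.
pose B := \sum_(f <- F) `|f|.
have FB f : f \in F -> `|f| <= B.
  by move=> fF; rewrite /B (big_rem f)//= lerDl sumr_ge0.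
have [L LP] := @segment_net R ((r + B + eps / 2) / d) (eps / 4 / `|g|)
  (divr_gt0 (divr_gt0 eps0 (ltr0n _ 4)) g0).
exists [seq f + l *: g | f <- F, l <- L] => z zr.
have [f [_ [fF [c [y [Yy ->]]] zf]]] := FP z zr.
have cK : `|c| <= (r + B + eps / 2) / d.
  rewrite ler_pdivlMr// mulrC (le_trans (dc _ _ Yy))//.
  have -> : c *: g + y = z - f - (z - f - (c *: g + y)) by rewrite subKr.
  apply: (le_trans (ler_normB _ _)); apply: lerD; last exact: ltW.
  by apply: (le_trans (ler_normB _ _)); apply: lerD => //; exact: FB.
have [l lL cl] := LP c cK.
exists (f + l *: g), y; split=> //; first exact: allpairs_f.
have -> : z - (f + l *: g) - y = (z - f - (c *: g + y)) + (c - l) *: g.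
  by rewrite scalerBl -exchange !opprD !addrA.
rewrite (le_lt_trans (ler_normD _ _))//.
rewrite ler_pdivlMr// -normrZ in cl; lra.
Qed.

(** * Approximate midpoints *)

(** The (1 + rho)-approximate midpoints between z and - z. *)
Definition lens (R : realType) (Z : normedModType R) (z : Z) (rho : R) :=
  [set m : Z | `|z + m| <= 1 + rho /\ `|z - m| <= 1 + rho].

Section Lens.
Context {R : realType} {Z : normedModType R}.
Implicit Types (z m y u : Z) (rho s d : R).

Let norm_half (a b : Z) (B : R) : `|a| <= B -> `|b| <= B ->
  `|2^-1 *: (a + b)| <= B.
Proof.
move=> aB bB; rewrite normrZ ger0_norm ?invr_ge0//.
have := ler_normD a b; lra.
Qed.

Let half_twice (z : Z) : 2^-1 *: (z + z) = z.
Proof.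
rewrite scalerDr -scalerDl; have -> : (2^-1 + 2^-1 : R) = 1 by field.
exact: scale1r.
Qed.

Lemma lens_half_sub z rho m m' :
  lens z rho m -> lens z rho m' -> lens z rho (2^-1 *: (m - m')).
Proof.
move=> [zm zm_] [zm' zm'_]; split.
  have -> : z + 2^-1 *: (m - m') = 2^-1 *: ((z + m) + (z - m')).
    by rewrite -[X in X + _]half_twice -scalerDr addrACA.
  exact: norm_half.
have -> : z - 2^-1 *: (m - m') = 2^-1 *: ((z - m) + (z + m')).
  rewrite -[X in X - _]half_twice -scalerBr; congr (_ *: _).
  by rewrite opprB addrACA addrC.
exact: norm_half.
Qed.

Lemma lens_le z rho m : lens z rho m -> `|m| <= 1 + rho.
Proof.
move=> [zm zm_]; have -> : m = 2^-1 *: ((z + m) + - (z - m)).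
  rewrite -[LHS]half_twice; congr (_ *: _).
  by rewrite opprB (addrC z) addrACA subrr addr0.
by apply: norm_half => //; rewrite normrN.
Qed.

Lemma norm_segment z y (lam B : R) : 0 <= lam <= 1 ->
  `|z + y| <= B -> `|z - y| <= B -> `|z + lam *: y| <= B.
Proof.
move=> /andP[l0 l1] zy zy'.
have -> : z + lam *: y = ((1 + lam) / 2) *: (z + y) + ((1 - lam) / 2) *: (z - y).
  rewrite scalerDr scalerBr addrACA -scalerDl -scalerBl.
  have -> : (1 + lam) / 2 + (1 - lam) / 2 = 1 by field.
  have -> : (1 + lam) / 2 - (1 - lam) / 2 = lam by field.
  by rewrite scale1r.
have lp : 0 <= (1 + lam) / 2 by lra.
have lm : 0 <= (1 - lam) / 2 by lra.
rewrite (le_trans (ler_normD _ _))// normrZ (ger0_norm lp) normrZ (ger0_norm lm).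
have : (1 + lam) / 2 * `|z + y| <= (1 + lam) / 2 * B by rewrite ler_wpM2l.
have : (1 - lam) / 2 * `|z - y| <= (1 - lam) / 2 * B by rewrite ler_wpM2l.
lra.
Qed.

Lemma lens_scale z rho m (lam : R) : 0 <= lam <= 1 ->
  lens z rho m -> lens z rho (lam *: m).
Proof.
move=> l01 [zm zm_]; split; first exact: norm_segment.
by rewrite -scalerN; apply: norm_segment => //; rewrite opprK.
Qed.

(** The lower bound at the vectors of norm s propagates outwards, since the
    lens is star-shaped about 0. *)
Lemma lens_subspace_lt z (Y : set Z) s rho y :
  submod_closed (mem Y) -> 0 < s ->
  (forall u, Y u -> `|u| = 1 ->
    1 + rho < Num.max `|z + s *: u| `|z - s *: u|) ->
  Y y -> lens z rho y -> `|y| < s.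
Proof.
move=> /submod_setP[Y0 YD] s0 Ys Yy zy; rewrite ltNge; apply/negP => sy.
have y0 : 0 < `|y| by exact: lt_le_trans sy.
have : lens z rho ((s / `|y|) *: y).
  apply: lens_scale => //; apply/andP; split.
    by rewrite divr_ge0// ltW.
  by rewrite ler_pdivrMr// mul1r.
have := Ys (`|y|^-1 *: y); rewrite scalerA.
have Yu : Y (`|y|^-1 *: y) by rewrite -[_ *: _]addr0; exact: YD.
have -> : `| `|y|^-1 *: y | = 1.
  by rewrite normrZ normfV normr_id mulVf// gt_eqF.
move=> /(_ Yu erefl); rewrite lt_max => + [le1 le2].
by rewrite !ltNge le1 le2.
Qed.

(** Group the points of the lens by a net modulo Y and pick one point in each
    nonempty group: the half-difference of two points of a group is in the lens
    and within eps of Y, so that its norm is less than s + eps. *)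
Lemma lens_net z (Y : set Z) s d :
  submod_closed (mem Y) -> finite_codim Y -> 0 < s -> 0 < d ->
  (forall u, Y u -> `|u| = 1 ->
    1 + d <= Num.max `|z + s *: u| `|z - s *: u|) ->
  exists F : seq Z, forall m, lens z (d / 3) m ->
    exists2 f, f \in F & `|m - f| < 4 * s.
Proof.
move=> sY cY s0 d0 Ys; have /submod_setP[Y0 YD] := sY.
pose eps := Num.min (d / 3) s.
have eps0 : 0 < eps by rewrite lt_min s0 andbT divr_gt0.
have epsd : eps <= d / 3 by rewrite ge_min lexx.
have epss : eps <= s by rewrite ge_min lexx orbT.
have [F FP] := finite_codim_net (1 + d / 3) sY cY eps0.
(* The net is external to the lens; m' below replaces the net point f by a lens
   point of the same group. *)
pose group f := [set m | lens z (d / 3) m /\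
  exists2 y, Y y & `|m - f - y| < eps].
exists [seq xget 0 (group f) | f <- F] => m zm.
have [f [y [fF Yy mfy]]] := FP m (lens_le zm).
have fm : group f m by split=> //; exists y.
have [zm' [y' Yy' mfy']] := xgetI 0 fm; set m' := xget _ _ in zm' mfy' *.
exists m'; first by apply/mapP; exists f.
pose v := 2^-1 *: (y - y'); pose w := 2^-1 *: (m - m').
have wv : `|w - v| < eps.
  have -> : w - v = 2^-1 *: ((m - f - y) - (m' - f - y')).
    rewrite -scalerBr; congr (_ *: _).
    rewrite -[m - m'](subrKA f) -(opprB m' f).
    move: (m - f) (m' - f) => a b.
    by rewrite !opprD !opprK addrACA.
  rewrite normrZ ger0_norm ?invr_ge0//.
  have := ler_normB (m - f - y) (m' - f - y'); lra.
have Yv : Y v.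
  have -> : v = (- 2^-1) *: y' + (2^-1 *: y + 0).
    by rewrite /v scalerBr addr0 scaleNr addrC.
  by apply: (YD _ _ _ Yy'); exact: YD.
have [zw zw_] := lens_half_sub zm zm'; rewrite -/w in zw zw_.
(* Since d / 3 + eps < d, the vector v of Y, which is eps-close to w, still lies
   in a lens to which the lower bound on Y applies. *)
have zv : lens z (d / 3 + eps) v.
  split.
    have -> : z + v = (z + w) - (w - v) by rewrite opprB addrACA subrr addr0.
    by rewrite [leRHS]addrA (le_trans (ler_normB _ _))// lerD// ltW.
  have -> : z - v = (z - w) + (w - v) by rewrite subrKA.
  by rewrite [leRHS]addrA (le_trans (ler_normD _ _))// lerD// ltW.
have vs : `|v| < s.
  apply: (lens_subspace_lt sY s0 _ Yv zv) => u Yu u1.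
  by apply: lt_le_trans (Ys u Yu u1); lra.
have ws : `|w| < s + eps.
  have -> : w = v + (w - v) by rewrite addrC subrK.
  by rewrite (le_lt_trans (ler_normD _ _))// ltrD.
move: ws; rewrite /w normrZ ger0_norm ?invr_ge0//; lra.
Qed.

End Lens.

(** * Annihilators of finite sets in the dual *)

Section Annihilator.
Context {R : realType} {X : normedModType R}.

Definition annihilator (xs : seq X) : set (dual X) :=
  [set g | forall x, x \in xs -> g x = 0 :> R].

Lemma submod_annihilator xs : submod_closed (mem (annihilator xs)).
Proof.
apply/submod_setP; split=> [x _|a u v u0 v0 x xx]; first by [].
by rewrite dualDE dualZE u0// v0// addr0 mulr0.
Qed.

(** One more point x raises the codimension by at most one: if some g in the
    annihilator does not vanish at x, then g spans the difference. *)
Lemma finite_codim_annihilator xs : finite_codim (annihilator xs).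
Proof.
elim: xs => [|x xs [n [e eP]]].
  by exists 0, (fun=> 0) => z; exists (fun=> 0) => x.
have [[g gxs gx]|h] := pselect (exists2 g, annihilator xs g & g x != 0).
  exists n.+1, (fun i => if unlift ord0 i is Some j then e j else g) => z.
  have [c cP] := eP z; set z' : dual X := z - _ in cP.
  exists (fun i => if unlift ord0 i is Some j then c j else z' x / g x).
  rewrite big_ord_recl unlift_none.
  under eq_bigr do rewrite liftK.
  rewrite opprD addrCA -/z' addrC => y; rewrite inE dualBE dualZE.
  case/predU1P => [->|yxs]; first by rewrite divfK// subrr.
  rewrite (cP y yxs) (gxs y yxs).
  by move: (_ / _) => a; rewrite (mulr0 a) subr0.
exists n, e => z; have [c cP] := eP z; exists c => y.
rewrite inE => /predU1P[->|/cP//].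
by apply: contra_notP h => /eqP zx; exists (z - \sum_(i < n) c i *: e i).
Qed.

Lemma weak_star_eval_continuous (x : X) :
  continuous (fun g : weak_star X => (g : dual X) x : R^o).
Proof.
move=> g.
apply: (@continuous_comp _ _ _ (@dual_fun R X : weak_star X -> {ptws X -> R^o})
  (fun h : {ptws X -> R^o} => h x)).
  exact: initial_continuous.
exact: proj_continuous.
Qed.

Lemma weak_star_closed_annihilator xs :
  closed (annihilator xs : set (weak_star X)).
Proof.
have -> : (annihilator xs : set (weak_star X)) = \bigcap_(x in [set` xs])
    [set g : weak_star X | (g : dual X) x = 0].
  by apply/seteqP; split.
apply: closed_bigI => x _.
apply: (@preimage_closed _ _ (fun g : weak_star X => (g : dual X) x : R^o)
  [set 0]) => [g _|]; first exact: weak_star_eval_continuous.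
exact: closed_eq.
Qed.

Lemma cvg_dual_eval (F : set_system (dual X)) (g : dual X) (x : X) :
  Filter F -> F --> g -> (fun h : dual X => h x : R^o) @ F --> (g x : R^o).
Proof.
move=> FF Fg; apply/cvgrPdist_lt => e e0.
have e0' : 0 < e / (1 + `|x|) by rewrite divr_gt0// ltr_pwDl.
have Fe : \forall h \near F, `|g - h| < e / (1 + `|x|).
  by move/cvgrPdist_lt: Fg; apply.
near=> h; rewrite -dualBE (le_lt_trans (dual_norm_ub _ _))//.
apply: (@le_lt_trans _ _ (`|g - h| * (1 + `|x|))).
  by rewrite ler_wpM2l ?dual_norm_ge0// lerDr.
rewrite -ltr_pdivlMr ?ltr_pwDl//; near: h.
Unshelve. all: by end_near. Qed.

Lemma weak_star_closed_closed (Y : set (dual X)) :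
  closed (Y : set (weak_star X)) -> closed Y.
Proof.
suff idc : continuous (id : dual X -> weak_star X).
  by move=> cY; apply: (@preimage_closed (dual X) (weak_star X) id Y) => // g _;
    exact: idc.
apply: continuous_comp_initial => g.
have FF : Filter ((@dual_fun R X : dual X -> X -> R^o) @ g).
  exact: fmap_filter (nbhs_filter g).
refine (proj2 (@pointwise_cvgP X R^o _ (@dual_fun R X g) FF) _) => x.
exact: (@cvg_dual_eval (nbhs g) g x (nbhs_filter g) cvg_id).
Qed.

Lemma dual_norm_almost_attained (f : dual X) (e : R) : 0 < e ->
  exists2 x : X, `|x| <= 1 & `|f| - e < `|f x|.
Proof.
move=> e0; have [_ [x x1 <-] xe] := sup_adherent e0 (dual_norm_has_sup f).
by exists x.
Qed.

(** The points of xs almost norm the elements of F; so if g vanishes on xs and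
    is close to f, then f itself is small. *)
Lemma annihilator_small (F : seq (dual X)) (s : R) : 0 < s ->
  exists xs : seq X, forall g f, annihilator xs g -> f \in F ->
    `|g - f| < 4 * s -> `|g| < 9 * s.
Proof.
move=> s0; have /choice[x_ xP] : forall f : dual X, exists x : X,
    `|x| <= 1 /\ `|f| - s < `|f x|.
  by move=> f; have [x] := dual_norm_almost_attained f s0; exists x.
exists [seq x_ f | f <- F] => g f gF fF gf.
have [x1 fx] := xP f.
have fgx : `|f (x_ f)| <= `|g - f|.
  rewrite -normrN -[- _]add0r -(gF (x_ f)) ?map_f// -dualBE.
  exact: dual_norm_ub1.
have := ler_normD (g - f) f; rewrite subrK; lra.
Qed.

End Annihilator.

Theorem mainTheorem7 (R : realType) (X : completeNormedModType R) :
  AMUC (dual X) <-> AMUC_star X.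
Proof.
split=> /amuc_wrtP amucX; apply/amuc_wrtP => t t0.
  have s0 : 0 < t / 9 by rewrite divr_gt0.
  have [d d0 dP] := amucX _ s0.
  exists (d / 3); first by rewrite divr_gt0.
  move=> z z1; have [Y [sY cY _ YP]] := dP z z1.
  have [F FP] := lens_net sY cY s0 d0 YP.
  have [xs xsP] := annihilator_small F s0.
  exists (annihilator xs); split.
  - exact: submod_annihilator.
  - exact: finite_codim_annihilator.
  - exact: weak_star_closed_annihilator.
  move=> y Yy y1; rewrite leNgt gt_max; apply/negP => /andP[/ltW zy /ltW zy_].
  have [f fF ty] := FP (t *: y) (conj zy zy_).
  have Yty : annihilator xs (t *: y).
    by move=> x xx; rewrite dualZE Yy// mulr0.
  have := xsP _ _ Yty fF ty.
  by rewrite normrZ y1 gtr0_norm//; lra.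
have [d d0 dP] := amucX t t0; exists d => // z z1.
have [Y [sY cY /weak_star_closed_closed clY YP]] := dP z z1.
by exists Y; split.
Qed.
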